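(* Let $a=(a_i)_{i\in\mathbb Z}$ be a sequence in $\Bbbk$ with dual sequence $\hat a$. There is an anti-algebra isomorphism $\omega_a\colon\mathrm{Sym}^a\to\mathrm{Sym}^{\hat a}$ defined by $\omega_a(S_{k;a})=\Lambda_{k;\hat a}$, and it satisfies $\omega_{\hat a}\omega_a=\mathrm{Id}$. It follows that $\omega_a(\Lambda_{k;a})=S_{k;\hat a}$.
   Context: $\Bbbk$ is a field of characteristic zero and $a=(a_i)_{i\in\mathbb Z}$ is a sequence in $\Bbbk$. Put $(t\downarrow a)^k=(t-a_1)\cdots(t-a_k)$, $(t\downarrow a)^0=1$, and $\hat a_i=-a_{-i+1}$ (so $\hat{\hat a}=a$). $\mathrm{Sym}^a=\Bbbk\langle S_{1;a},S_{2;a},\ldots\rangle$ is the free associative unital $\Bbbk$-algebra on $S_{k;a}$, $k\ge1$. With $t$ a central variable and all expressions expanded as formal power series in $1/t$, put $\sigma^a(t)=\sum_{k\ge0}S_{k;a}/(t\downarrow a)^k$ and $\lambda^{\hat a}(t)=\sum_{k\ge0}\Lambda_{k;a}/(t\downarrow\hat a)^k$ with $S_{0;a}=\Lambda_{0;a}=1$; the elements $\Lambda_{k;a}\in\mathrm{Sym}^a$ are determined by $\lambda^{\hat a}(-t)\sigma^a(t)=\sigma^a(t)\lambda^{\hat a}(-t)=1$. The same definitions apply to $\hat a$ in place of $a$, giving $\mathrm{Sym}^{\hat a}$, $S_{k;\hat a}$, $\Lambda_{k;\hat a}$. An anti-algebra isomorphism is a bijective $\Bbbk$-linear unital map reversing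 products. *)

(* Defs.v *)
From HB Require Import structures.
From mathcomp Require Import all_boot all_algebra.
From mathcomp Require Import monalg.

Set Implicit Arguments.
Unset Strict Implicit.
Unset Printing Implicit Defensive.

Import GRing.Theory.
Local Open Scope ring_scope.

Lemma strong_recursion (T : Type) (x0 : T) (step : (nat -> T) -> nat -> T) :
    (forall g h n, (forall i, (i < n)%N -> g i = h i) -> step g n = step h n) ->
  {g : nat -> T | forall n, g n = step g n}.
Proof.
move=> step_loc.
pose build := fix build n :=
  if n is m.+1 then rcons (build m) (step (nth x0 (build m)) m) else [::].
have sz n : size (build n) = n by elim: n => //= n IH; rewrite size_rcons IH.
have nthE n i : (i < n)%N -> nth x0 (build n) i = step (nth x0 (build i)) i.
  elim: n => // n IH; rewrite ltnS leq_eqVlt => /predU1P[->|lt_in] /=.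
    by rewrite nth_rcons sz ltnn eqxx.
  by rewrite nth_rcons sz lt_in IH.
exists (fun n => step (nth x0 (build n)) n) => n.
by apply: step_loc => i lt_in; apply: nthE.
Qed.

(* A formal power series in 1/t, with t central, is the sequence of its
   coefficients: f n is the coefficient of t^-n. *)
Section Series.
Variable A : nzRingType.
Implicit Types f g h : nat -> A.

Definition series1 : nat -> A := fun n => (n == 0)%:R.

Definition series_mul f g : nat -> A :=
  fun n => \sum_(i < n.+1) f i * g (n - i)%N.

(* f(-t) *)
Definition series_negt f : nat -> A := fun n => (-1) ^+ n * f n.

Lemma series_mul_trunc N f g n : (n < N)%N ->
  (\poly_(i < N) f i * \poly_(i < N) g i)`_n = series_mul f g n.
Proof.
move=> nN; rewrite coefM; apply: eq_bigr => i _; rewrite !coef_poly.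
by rewrite (leq_ltn_trans (leq_subr _ _) nN) (leq_trans (ltn_ord i) nN).
Qed.

Lemma eq_series_mul f f' g g' :
  f =1 f' -> g =1 g' -> series_mul f g =1 series_mul f' g'.
Proof. by move=> ff' gg' n; apply: eq_bigr => i _; rewrite ff' gg'. Qed.

Lemma series_mulA f g h :
  series_mul f (series_mul g h) =1 series_mul (series_mul f g) h.
Proof.
move=> n; pose P u : {poly A} := \poly_(i < n.+1) u i.
have lowl (u v p : {poly A}) : (forall i, (i <= n)%N -> u`_i = v`_i) ->
  (u * p)`_n = (v * p)`_n.
  move=> uv; rewrite !coefM; apply: eq_bigr => i _.
  by rewrite uv // -ltnS.
have lowr (u v p : {poly A}) : (forall i, (i <= n)%N -> u`_i = v`_i) ->
  (p * u)`_n = (p * v)`_n.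
  move=> uv; rewrite !coefM; apply: eq_bigr => i _.
  by rewrite uv // leq_subr.
have PM u v i : (i <= n)%N -> (P (series_mul u v))`_i = (P u * P v)`_i.
  by move=> le_in; rewrite series_mul_trunc // coef_poly ltnS le_in.
rewrite -(@series_mul_trunc n.+1) // -[RHS](@series_mul_trunc n.+1) //.
rewrite [LHS](lowr _ (P g * P h)); last exact: PM.
rewrite [RHS](lowl _ (P f * P g)); last exact: PM.
by rewrite mulrA.
Qed.

Lemma series_mul1l f : series_mul series1 f =1 f.
Proof.
move=> n; rewrite /series_mul big_ord_recl mul1r subn0 big1 ?addr0 // => i _.
by rewrite mul0r.
Qed.

Lemma series_mul1r f : series_mul f series1 =1 f.
Proof.
move=> n; rewrite /series_mul big_ord_recr /= subnn mulr1 big1 ?add0r // => i _.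
by rewrite /series1 subn_eq0 leqNgt ltn_ord mulr0.
Qed.

Lemma eq_series_negt f g : f =1 g -> series_negt f =1 series_negt g.
Proof. by move=> fg n; rewrite /series_negt fg. Qed.

Lemma series_negtK f : series_negt (series_negt f) =1 f.
Proof. by move=> n; rewrite /series_negt signrMK. Qed.

Lemma right_inverse_series f : f 0%N = 1 ->
  {g : nat -> A | g 0%N = 1 & series_mul f g =1 series1}.
Proof.
move=> f0.
pose step g n := series1 n - \sum_(i < n) f i.+1 * g (n - i.+1)%N.
have [|g gE] := @strong_recursion A 0 step.
  move=> g h n gh; congr (_ - _); apply: eq_bigr => i _.
  by rewrite gh // ltn_subrL /= (leq_ltn_trans _ (ltn_ord i)).
exists g; first by rewrite gE /step big_ord0 subr0.
by move=> n; rewrite /series_mul big_ord_recl f0 mul1r subn0 gE subrK.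
Qed.

Lemma inverse_series f : f 0%N = 1 ->
  {g : nat -> A | series_mul g f =1 series1 & series_mul f g =1 series1}.
Proof.
move=> /right_inverse_series[g g0 fg]; exists g => //.
have [h _ gh] := right_inverse_series g0.
have fh : f =1 h.
  move=> n; rewrite -[LHS]series_mul1r -(eq_series_mul (frefl f) gh) series_mulA.
  by rewrite (eq_series_mul fg (frefl h)) series_mul1l.
by move=> n; rewrite (eq_series_mul (frefl g) fh) gh.
Qed.

End Series.

Section Algebra.
Variable K : fieldType.
Implicit Types a b : int -> K.

Definition dual a : int -> K := fun i => - a (- i + 1).

Lemma dualK a : dual (dual a) =1 a.
Proof. by move=> i; rewrite /dual opprK opprD opprK subrK. Qed.

(* 1/(t - c) = \sum_(n >= 1) c^(n-1) t^-n *)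
Definition inv_linear (c : K) : nat -> K :=
  fun n => if n is m.+1 then c ^+ m else 0.

(* 1/((t - a_1) ... (t - a_k)) *)
Fixpoint inv_falling a (k : nat) : nat -> K :=
  if k is j.+1 then series_mul (inv_falling a j) (inv_linear (a k))
  else series1 K.

Lemma inv_falling_lt a k n : (n < k)%N -> inv_falling a k n = 0.
Proof.
elim: k n => // k IH n; rewrite ltnS => le_nk /=.
rewrite /series_mul big_ord_recr /= subnn mulr0 addr0 big1 // => i _.
by rewrite IH ?mul0r // (leq_trans (ltn_ord i)).
Qed.

Lemma inv_falling_diag a k : inv_falling a k k = 1.
Proof.
elim: k => // k IH /=; rewrite /series_mul !big_ord_recr /= subnn mulr0 addr0.
rewrite subSnn /= IH mul1r big1 ?add0r // => i _.
by rewrite inv_falling_lt ?mul0r.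
Qed.

(* (t - a_(k+1)) / (t \downarrow a)^(k+1) = 1 / (t \downarrow a)^k *)
Lemma inv_fallingS a k n :
  inv_falling a k.+1 n.+1 - a k.+1 * inv_falling a k.+1 n = inv_falling a k n.
Proof.
rewrite /= /series_mul big_ord_recr /= subnn mulr0 addr0.
rewrite big_ord_recr /= subSnn mulr1.
rewrite [\sum_(i < n.+1) _]big_ord_recr /= subnn mulr0 addr0 mulr_sumr.
rewrite addrAC -sumrB big1 ?add0r // => i _.
by rewrite subSn 1?ltnW // -[in inv_linear _ (n - i)](subnSK (ltn_ord i)) /=
  -[in X in _ ^+ X](subnSK (ltn_ord i)) exprS mulrCA subrr.
Qed.

(* \sum_(k >= 0) X_k / (t \downarrow b)^k; the terms with k > n do not
   contribute to the coefficient of t^-n. *)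
Definition falling_series b (A : algType K) (X : nat -> A) : nat -> A :=
  fun n => \sum_(k < n.+1) inv_falling b k n *: X k.

Section FallingSeries.
Variables (b : int -> K) (A : algType K).
Implicit Types (X Y f : nat -> A).

Lemma falling_seriesE X n : falling_series b X n =
  \sum_(k < n) inv_falling b k n *: X k + X n.
Proof. by rewrite /falling_series big_ord_recr /= inv_falling_diag scale1r. Qed.

Lemma falling_series_inj X Y :
  falling_series b X =1 falling_series b Y -> X =1 Y.
Proof.
move=> XY n; elim/ltn_ind: n => n IH.
have := XY n; rewrite !falling_seriesE.
rewrite (eq_bigr (fun k : 'I_n => inv_falling b k n *: Y k)); last first.
  by move=> k _; rewrite IH.
by move/addrI.
Qed.

Lemma falling_series_surj f : {X : nat -> A | falling_series b X =1 f}.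
Proof.
pose step X n := f n - \sum_(k < n) inv_falling b k n *: X k.
have [|X XE] := @strong_recursion A 0 step.
  by move=> X Y n XY; congr (_ - _); apply: eq_bigr => k _; rewrite XY.
by exists X => n; rewrite falling_seriesE [X n]XE addrC subrK.
Qed.

End FallingSeries.

Definition anti_algebra_morphism (A B : algType K) (f : A -> B) : Prop :=
  [/\ linear f, f 1 = 1 & forall x y, f (x * y) = f y * f x].

Definition anti_algebra_isomorphism (A B : algType K) (f : A -> B) : Prop :=
  anti_algebra_morphism f /\ bijective f.

(* The free algebra on S_1, S_2, ...; the letter i : nat stands for S_(i+1).
   The index a only records the sequence the generators are attached to. All
   the types Sym a are convertible; in particular an element of
   Sym (dual (dual a)) may be read in Sym a, with the same generators by
   computation and the same Lambda_k by Lambda_dualK. *)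
Definition Sym (a : int -> K) : Type := {malg K[{fmonom nat}]}.

HB.instance Definition _ a := GRing.Lalgebra.on (Sym a).

Lemma Sym_scalerAr a (c : K) (x y : Sym a) : c *: (x * y) = x * (c *: y).
Proof.
have comm_malgC : c%:MP * x = x * c%:MP :> {malg K[{fmonom nat}]}.
  rewrite [LHS]malgM_def [RHS]malgM_def fgmulUg fgmulgU.
  by apply: eq_bigr => k _; rewrite mul1m mulm1 mulrC.
by rewrite -[LHS]mul_malgC -[c *: y]mul_malgC !mulrA comm_malgC.
Qed.

HB.instance Definition _ a :=
  GRing.Lalgebra_isAlgebra.Build K (Sym a) (@Sym_scalerAr a).

(* S_{k;a}, with S_{0;a} = 1 *)
Definition Sgen a (k : nat) : Sym a :=
  if k is i.+1 then << fmu i >> else 1.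

(* sigma^a(t) *)
Definition sigma a : nat -> Sym a := falling_series a (Sgen a).

(* lambda^{dual a}(t), for a family L of candidates for the Lambda_{k;a} *)
Definition lambda_of a (L : nat -> Sym a) : nat -> Sym a :=
  falling_series (dual a) L.

Definition is_Lambda a (L : nat -> Sym a) : Prop :=
  [/\ L 0%N = 1,
      series_mul (series_negt (lambda_of L)) (sigma a) =1 @series1 (Sym a) &
      series_mul (sigma a) (series_negt (lambda_of L)) =1 @series1 (Sym a)].

Lemma Lambda_unique a (L L' : nat -> Sym a) :
  is_Lambda L -> is_Lambda L' -> L =1 L'.
Proof.
move=> [_ Ls _] [_ _ sL']; apply: (@falling_series_inj (dual a)) => n.
rewrite -[LHS]series_negtK -[RHS]series_negtK.
apply: eq_series_negt => {}n.
rewrite -[LHS]series_mul1r -(eq_series_mul (frefl _) sL') series_mulA.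
by rewrite (eq_series_mul Ls (frefl _)) series_mul1l.
Qed.

Lemma Lambda_exists a : {L : nat -> Sym a | is_Lambda L}.
Proof.
have s0 : sigma a 0%N = 1.
  by rewrite /sigma falling_seriesE big_ord0 add0r.
have [g gs sg] := inverse_series s0.
have [L LE] := falling_series_surj (dual a) (series_negt g).
have LK : series_negt (lambda_of L) =1 g.
  by move=> n; rewrite (eq_series_negt LE) series_negtK.
exists L; split.
- have := LE 0%N; rewrite falling_seriesE big_ord0 add0r => ->.
  have := sg 0%N; rewrite /series_mul big_ord1 s0 mul1r => g0.
  by rewrite /series_negt g0 mul1r.
- by move=> n; rewrite (eq_series_mul LK (frefl _)) gs.
- by move=> n; rewrite (eq_series_mul (frefl _) LK) sg.
Qed.

(* Lambda_{k;a}: the unique family such that is_Lambda holds *)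
Definition Lambda a : nat -> Sym a := sval (Lambda_exists a).

Lemma LambdaP a : is_Lambda (Lambda a).
Proof. exact: svalP (Lambda_exists a). Qed.

Lemma inv_falling_ext a b : a =1 b -> forall k, inv_falling a k =1 inv_falling b k.
Proof.
move=> ab; elim=> //= k IH; apply: eq_series_mul => // n.
by rewrite /inv_linear ab.
Qed.

Lemma Lambda_dualK a k : Lambda (dual (dual a)) k = Lambda a k :> Sym a.
Proof.
have [L0 Ls sL] := LambdaP (dual (dual a)).
apply: (@Lambda_unique a _ _ _ (LambdaP a)) k.
have ser b b' (X : nat -> Sym a) : b =1 b' ->
    falling_series b X =1 falling_series b' X.
  by move=> bb' n; apply: eq_bigr => k _; rewrite (inv_falling_ext bb').
have Es := ser _ _ (Sgen a) (dualK a).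
have dE : dual (dual (dual a)) =1 dual a by move=> i; rewrite dualK.
have El : series_negt (lambda_of (Lambda (dual (dual a)))) =1
    series_negt (@lambda_of a (Lambda (dual (dual a)))).
  exact: eq_series_negt (ser _ _ _ dE).
split; first exact: L0.
- by move=> n; exact: etrans (esym (eq_series_mul El Es n)) (Ls n).
- by move=> n; exact: etrans (esym (eq_series_mul Es El n)) (sL n).
Qed.
End Algebra.

(* Main.v *)
Require Import Defs.
From mathcomp Require Import all_boot all_algebra.
From mathcomp Require Import monalg.

Set Implicit Arguments.
Unset Strict Implicit.
Unset Printing Implicit Defensive.

Import GRing.Theory.
Local Open Scope ring_scope.

(** The anti-morphism omega_a exists and is unique because Sym^a is free on
    the S_k: a word in the generators must go to the product of the images of
    its letters in the opposite order.

    The point is the value of omega_a on Lambda_k. Apply omega_a to the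
    identity lambda^{dual a}(-t) sigma^a(t) = 1. It turns the product around,
    it commutes with t and with the denominators, and it sends sigma^a(t) to
    lambda^a(t), the lambda series of Sym^{dual a}. With mu(t) the image of
    lambda^{dual a}(t), this reads lambda^a(t) mu(-t) = 1, hence
    lambda^a(-t) mu(t) = 1, so that mu(t) is the inverse of lambda^a(-t), which
    is sigma^{dual a}(t) by the definition of the Lambda's of Sym^{dual a}.
    Both mu(t) and sigma^{dual a}(t) are expanded in the series
    1/(t \downarrow dual a)^k, and such an expansion has unique coefficients:
    omega_a (Lambda_k) = S_k ([anti_morphism_Lambda]).

    Since double duals give back the same sequence, omega_{dual a} sends
    Lambda_{k; dual a} to S_{k; a} in the same way. So the morphisms
    omega_{dual a} omega_a and omega_a omega_{dual a} fix the generators: they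
    are identities ([anti_morphisms_cancel]), and omega_a is bijective. *)

Section SeriesInverse.
Variable A : nzRingType.
Implicit Types f g h : nat -> A.

Lemma series_inverse_unique f g h :
  series_mul g f =1 series1 A -> series_mul f h =1 series1 A -> g =1 h.
Proof.
move=> gf fh n.
rewrite -[LHS]series_mul1r -(eq_series_mul (frefl g) fh) series_mulA.
by rewrite (eq_series_mul gf (frefl h)) series_mul1l.
Qed.

Lemma series_negtM f g :
  series_negt (series_mul f g) =1 series_mul (series_negt f) (series_negt g).
Proof.
move=> n; rewrite /series_negt /series_mul mulr_sumr; apply: eq_bigr => i _.
rewrite -{1}(subnKC (leq_ord i)) exprD !mulrA; congr (_ * _).
by rewrite -!mulrA (commr_sign (f i)).
Qed.

Lemma series_negt1 : series_negt (series1 A) =1 series1 A.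
Proof. by case=> [|n]; rewrite /series_negt /series1 ?mul1r ?mulr0. Qed.

End SeriesInverse.

Lemma eq_falling_series (K : fieldType) (b b' : int -> K) (A : algType K)
    (X X' : nat -> A) :
  b =1 b' -> X =1 X' -> falling_series b X =1 falling_series b' X'.
Proof.
by move=> bb' XX' n; apply: eq_bigr => k _; rewrite (inv_falling_ext bb') XX'.
Qed.

Section AntiMorphism.
Variables (K : fieldType) (A B : algType K) (f : A -> B).
Hypothesis f_anti : anti_algebra_morphism f.

Lemma anti_morphism0 : f 0 = 0.
Proof.
have [f_lin _ _] := f_anti.
by have := f_lin (- 1) 0 0; rewrite !scaleN1r oppr0 addr0 addNr.
Qed.

Lemma anti_morphism_sum (I : Type) (r : seq I) (F : I -> A) :
  f (\sum_(i <- r) F i) = \sum_(i <- r) f (F i).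
Proof.
have [f_lin _ _] := f_anti.
have fD x y : f (x + y) = f x + f y by rewrite -[x]scale1r f_lin !scale1r.
exact: (big_morph f fD anti_morphism0).
Qed.

Lemma anti_morphismZ c x : f (c *: x) = c *: f x.
Proof.
by have [f_lin _ _] := f_anti; rewrite -[c *: x]addr0 f_lin anti_morphism0 addr0.
Qed.

Lemma anti_morphism_series_mul (F G : nat -> A) :
  f \o series_mul F G =1 series_mul (f \o G) (f \o F).
Proof.
have [_ _ fM] := f_anti.
move=> n /=; rewrite anti_morphism_sum /series_mul (reindex_inj rev_ord_inj) /=.
by apply: eq_bigr => i _; rewrite fM subSS subKn ?leq_ord.
Qed.

Lemma anti_morphism_negt (F : nat -> A) :
  f \o series_negt F =1 series_negt (f \o F).
Proof.
have signE (C : algType K) (x : C) n : (-1) ^+ n * x = (-1) ^+ n *: x.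
  by rewrite -mulr_algl -in_algE rmorphXn rmorphN1.
by move=> n; rewrite /series_negt /= !signE anti_morphismZ.
Qed.

Lemma anti_morphism_falling_series b (X : nat -> A) :
  f \o falling_series b X =1 falling_series b (f \o X).
Proof.
move=> n /=; rewrite anti_morphism_sum.
by apply: eq_bigr => k _; rewrite anti_morphismZ.
Qed.

Lemma anti_morphism_series1 : f \o series1 A =1 series1 B.
Proof.
have [_ f1 _] := f_anti.
by case=> [|n]; rewrite /series1 /= ?f1 ?anti_morphism0.
Qed.

End AntiMorphism.

(** Words in the generators span Sym^a, and each word is a generator times a
    shorter word. This form serves both to compare anti-morphisms and to show
    that a composite of two of them is the identity. *)
Lemma Sym_ind (K : fieldType) (a : int -> K) (P : Sym a -> Prop) :
    P 1 ->
    (forall c x y, P x -> P y -> P (c *: x + y)) ->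
    (forall k x, (0 < k)%N -> P x -> P (Sgen a k * x)) ->
  forall x, P x.
Proof.
move=> P1 PD PM x.
have P0 : P 0 by rewrite -(addNr 1) -scaleN1r; apply: PD.
have Pword (s : seq nat) : P << FMonom s >>.
  elim: s => [|i s IH]; first by move: P1; rewrite -fmoneE.
  have -> : << FMonom (i :: s) >> = Sgen a i.+1 * << FMonom s >> :> Sym a.
    rewrite [RHS]malgM_def fgmulUU mulr1 /= /mmul /=.
    by rewrite fmmulE fmuE.
  exact: PM.
rewrite (monalgE x); elim: (finmap.enum_fset _) => [|m s IH].
  by rewrite big_nil.
rewrite big_cons.
have -> : << x@_m *g m >> = x@_m *: << m >> :> Sym a.
  by apply/malgP => k; rewrite mcoeffZ !mcoeffU mulrnAr mulr1.
by apply: PD => //; rewrite -(fmK m).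
Qed.

Section AntiLift.
Variables (K : fieldType) (a : int -> K) (A : algType K) (X : nat -> A).

Definition reverse_word (m : {fmonom nat}) : A := \prod_(i <- rev m) X i.+1.

Definition anti_lift : Sym a -> A := mmap (in_alg A) reverse_word.

Lemma anti_lift_morphism : anti_algebra_morphism anti_lift.
Proof.
split=> [c x y||x y]; rewrite /anti_lift.
- rewrite raddfD /=; congr (_ + _).
  rewrite (mmapEw (msuppZ_le _ _)) mmapE scaler_sumr.
  by apply: eq_bigr => m _; rewrite mcoeffZ /= !mulr_algl scalerA.
- by rewrite mmapU /= scale1r mul1r /reverse_word fm1 big_nil.
rewrite [x * y]malgME raddf_sum [mmap _ _ x]mmapE mulr_sumr /=.
apply: eq_bigr => m _.
rewrite raddf_sum [mmap _ _ y]mmapE mulr_suml /=; apply: eq_bigr => m' _.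
rewrite mmapU /= /reverse_word fmM rev_cat big_cat /=.
by rewrite !mulr_algl -scalerAl -scalerAr scalerA mulrC.
Qed.

Lemma anti_lift_Sgen k : (0 < k)%N -> anti_lift (Sgen a k) = X k.
Proof.
case: k => // i _; rewrite /anti_lift /= mmapU /= scale1r mul1r.
by rewrite /reverse_word fmU big_seq1.
Qed.

Lemma anti_lift_unique (f : Sym a -> A) :
  anti_algebra_morphism f -> (forall k, (0 < k)%N -> f (Sgen a k) = X k) ->
  f =1 anti_lift.
Proof.
move=> [f_lin f1 fM] fS; have [l_lin l1 lM] := anti_lift_morphism.
elim/Sym_ind => [|c x y fx fy|k x k_gt0 fx]; first by rewrite f1 l1.
  by rewrite f_lin l_lin fx fy.
by rewrite fM lM fx fS ?anti_lift_Sgen.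
Qed.

End AntiLift.

(** The composite of two anti-morphisms is a morphism, so it is the identity
    once it fixes the generators. *)
Lemma anti_morphisms_cancel (K : fieldType) (a : int -> K) (A : algType K)
    (f : Sym a -> A) (g : A -> Sym a) :
    anti_algebra_morphism f -> anti_algebra_morphism g ->
    (forall k, (0 < k)%N -> g (f (Sgen a k)) = Sgen a k) ->
  cancel f g.
Proof.
move=> [f_lin f1 fM] [g_lin g1 gM] gfS.
elim/Sym_ind => [|c x y gfx gfy|k x k_gt0 gfx]; first by rewrite f1 g1.
  by rewrite f_lin g_lin gfx gfy.
by rewrite fM gM gfx gfS.
Qed.

(** Because f reverses products, it carries the left inverse of sigma^a to a
    right inverse, and the change of t into -t moves the sign from one factor to
    the other. *)
Lemma anti_morphism_Lambda (K : fieldType) (a : int -> K)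
    (f : Sym a -> Sym (dual a)) :
    anti_algebra_morphism f ->
    (forall k, (0 < k)%N -> f (Sgen a k) = Lambda (dual a) k) ->
  forall k, f (Lambda a k) = Sgen (dual a) k.
Proof.
move=> f_anti fS; have [L0 _ sL] := LambdaP (dual a).
have [_ Ls _] := LambdaP a.
have f_sigma : f \o sigma a =1 lambda_of (Lambda (dual a)).
  move=> n; rewrite [LHS](anti_morphism_falling_series f_anti).
  apply: eq_falling_series => [i|[|k]]; [by rewrite dualK| |exact: fS].
  by have [_ f1 _] := f_anti; rewrite /= f1 L0.
pose mu := falling_series (dual a) (f \o Lambda a).
have f_lambda : f \o series_negt (lambda_of (Lambda a)) =1 series_negt mu.
  move=> n; rewrite (anti_morphism_negt f_anti).
  exact: eq_series_negt (anti_morphism_falling_series f_anti _ _) n.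
have lambda_mu : series_mul (lambda_of (Lambda (dual a))) (series_negt mu)
    =1 series1 (Sym (dual a)).
  move=> n; rewrite -(eq_series_mul f_sigma f_lambda).
  rewrite -(anti_morphism_series_mul f_anti) /= Ls.
  exact: (anti_morphism_series1 f_anti).
have mu_sigma : mu =1 sigma (dual a).
  apply: fsym; apply: series_inverse_unique sL _ => n.
  rewrite -(eq_series_mul (frefl _) (series_negtK mu)) -series_negtM.
  by rewrite (eq_series_negt lambda_mu) series_negt1.
exact: falling_series_inj mu_sigma.
Qed.

Theorem proposition9 (K : fieldType) (charK0 : [pchar K] =i pred0) :
  exists omega : forall a : int -> K, Sym a -> Sym (dual a),
    [/\ forall a, anti_algebra_isomorphism (omega a),
        forall a k, (0 < k)%N -> omega a (Sgen a k) = Lambda (dual a) k,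
        forall a (f : Sym a -> Sym (dual a)),
          anti_algebra_morphism f ->
          (forall k, (0 < k)%N -> f (Sgen a k) = Lambda (dual a) k) ->
          f =1 omega a,
        forall a (x : Sym a), omega (dual a) (omega a x) = x &
        forall a k, (0 < k)%N -> omega a (Lambda a k) = Sgen (dual a) k].
Proof.
pose omega a := @anti_lift K a (Sym (dual a)) (Lambda (dual a)).
have omega_anti a : anti_algebra_morphism (omega a).
  exact: anti_lift_morphism.
have omegaS a k : (0 < k)%N -> omega a (Sgen a k) = Lambda (dual a) k.
  exact: anti_lift_Sgen.
have omegaL a k : omega a (Lambda a k) = Sgen (dual a) k.
  exact: anti_morphism_Lambda (omega_anti a) (omegaS a) k.
have omegaK a : cancel (omega a) (omega (dual a) : Sym (dual a) -> Sym a).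
  apply: (@anti_morphisms_cancel K a (Sym (dual a)) (omega a) (omega (dual a))).
  - exact: omega_anti.
  - exact: omega_anti (dual a).
  - by move=> k k_gt0; rewrite omegaS // omegaL.
(* omega_{dual a} produces Lambdas of the double dual of a, which equals a
   only pointwise. *)
have omegaVK a : cancel (omega (dual a) : Sym (dual a) -> Sym a) (omega a).
  apply: (@anti_morphisms_cancel K (dual a) (Sym a) (omega (dual a)) (omega a)).
  - exact: omega_anti (dual a).
  - exact: omega_anti.
  - move=> k k_gt0; rewrite [X in omega a X](omegaS (dual a) k k_gt0).
    by rewrite [X in omega a X]Lambda_dualK omegaL.
exists omega; split.
- move=> a; split; first exact: omega_anti.
  exists (omega (dual a) : Sym (dual a) -> Sym a); first exact: omegaK.
  exact: omegaVK.
- exact: omegaS.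
- by move=> a f; apply: anti_lift_unique.
- exact: omegaK.
- by move=> a k _; apply: omegaL.
Qed.
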